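(* Let $H=H(\mathbf m,t,\mathsf d,\mathsf u)$ be a Nenciu type Hopf algebra. Then the left regular representation $(H,\cdot)$ decomposes as $$(H,\cdot)\cong\bigoplus_{\mathbf p\in\mathbb Z_{\mathbf m}}P_{\mathbf p},$$ where each $P_{\mathbf p}=H\omega_{\mathbf p}$ is a $2^t$-dimensional projective module, generated by acting on the fixed idempotent $\omega_{\mathbf p}$ with the nilpotent generators $X_1,\dots,X_t$.
   Context: Nenciu type Hopf algebra: let $s,t\ge1$, $\mathbf m=(m_1,\dots,m_s)\in\mathbb Z_{>0}^s$, $\xi_a=\exp(2\pi i/m_a)$, $\mathbb Z_{\mathbf m}=\prod_a\mathbb Z/m_a\mathbb Z$. For tuples, $\mathbf v\cdot\mathbf w$ is the entrywise product and $\boldsymbol\xi^{\mathbf v}=\prod_a\xi_a^{v_a}$, $\mathbf K^{\mathbf v}=\prod_aK_a^{v_a}$. Let $\mathsf d,\mathsf u$ be integer $t\times s$ matrices with rows $\mathsf d_k,\mathsf u_k$ satisfying $\boldsymbol\xi^{\mathsf d_k\cdot\mathsf u_l}\boldsymbol\xi^{\mathsf d_l\cdot\mathsf u_k}=1$ and $\boldsymbol\xi^{\mathsf d_k\cdot\mathsf u_k}=-1$ for all $k,l$. $H(\mathbf m,t,\mathsf d,\mathsf u)$ is the Hopf algebra over $\mathbb C$ generated by $K_1,\dots,K_s,X_1,\dots,X_t$ with relations $K_a^{m_a}=1$, $K_aK_b=K_bK_a$, $K_aX_k=\xi_a^{d_{ka}}X_kK_a$, $X_k^2=0$, $X_lX_k=\boldsymbol\xi^{\mathsf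 d_k\cdot\mathsf u_l}X_kX_l$; the $K_a$ are grouplike, $\Delta(X_k)=1\otimes X_k+X_k\otimes\mathbf K^{\mathsf u_k}$, $\epsilon(X_k)=0$, $S(X_k)=-X_k\mathbf K^{-\mathsf u_k}$. It has basis $\{\mathbf K^{\mathbf v}\mathbf X^{\mathbf r}:\mathbf v\in\mathbb Z_{\mathbf m},\mathbf r\in\{0,1\}^t\}$, $\mathbf X^{\mathbf r}=X_1^{r_1}\cdots X_t^{r_t}$. Idempotents: for $\mathbf p\in\mathbb Z_{\mathbf m}$, $\omega_{\mathbf p}=\prod_{a=1}^s\varphi^a_{p_a}$ with $\varphi^a_{p}=\frac1{m_a}\sum_{j=0}^{m_a-1}\xi_a^{-jp}K_a^j$. *)

(* Defs.v *)
From HB Require Import structures.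
From mathcomp Require Import all_boot all_order all_algebra.
From mathcomp Require Import sesquilinear complex.
From mathcomp Require Import boolp reals trigo.

Set Implicit Arguments.
Unset Strict Implicit.
Unset Printing Implicit Defensive.

Import Order.TTheory GRing.Theory Num.Theory.
Local Open Scope ring_scope.

(* Hopf algebras. A finite list [:: (v1, w1); ...; (vn, wn)] stands for the    *)
(* tensor v1 (x) w1 + ... + vn (x) wn of V (x) W; by the universal property of *)
(* the tensor product, two lists stand for the same tensor exactly when no     *)
(* bilinear map separates them. A comultiplication is thus given by a choice   *)
(* of representatives, and its axioms are stated up to [tensor_eq].            *)
Definition tensor_eq (F : fieldType) (V W : lmodType F) (s s' : seq (V * W)) :=
  forall (U : lmodType F) (B : {bilinear V -> W -> U}),
    \sum_(p <- s) B p.1 p.2 = \sum_(p <- s') B p.1 p.2.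

Definition trilinear (F : fieldType) (V U : lmodType F) (f : V -> V -> V -> U) :=
  [/\ forall y z, linear (fun x => f x y z),
      forall x z, linear (fun y => f x y z)
    & forall x y, linear (f x y)].

HB.mixin Record Algebra_isHopf (F : fieldType) H of GRing.Algebra F H := {
  comul : H -> seq (H * H);
  counit : {lrmorphism H -> F | *%R};
  antipode : {linear H -> H};
  comul_linear : forall (c : F) (x y : H),
    tensor_eq (comul (c *: x + y))
              ([seq (c *: p.1, p.2) | p <- comul x] ++ comul y);
  comul1 : tensor_eq (comul 1) [:: (1, 1)];
  comulM : forall x y : H,
    tensor_eq (comul (x * y))
              [seq (p.1 * q.1, p.2 * q.2) | p <- comul x, q <- comul y];
  comulA : forall (U : lmodType F) (f : H -> H -> H -> U) (x : H),
    trilinear f ->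
    \sum_(p <- comul x) \sum_(q <- comul p.1) f q.1 q.2 p.2 =
    \sum_(p <- comul x) \sum_(q <- comul p.2) f p.1 q.1 q.2;
  counitl : forall x : H, \sum_(p <- comul x) counit p.1 *: p.2 = x;
  counitr : forall x : H, \sum_(p <- comul x) counit p.2 *: p.1 = x;
  antipodel : forall x : H, \sum_(p <- comul x) antipode p.1 * p.2 = (counit x)%:A;
  antipoder : forall x : H, \sum_(p <- comul x) p.1 * antipode p.2 = (counit x)%:A
}.

#[short(type="hopfAlgType")]
HB.structure Definition HopfAlgebra (F : fieldType) :=
  {H of GRing.Algebra F H & Algebra_isHopf F H}.

(* exp(2 pi i / n) *)
Definition xi (R : realType) (n : nat) : R[i] :=
  (cos (2 * pi / n%:R) +i* sin (2 * pi / n%:R))%C.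

Definition xipow (R : realType) (s : nat) (m : 'I_s -> nat) (v : 'rV[int]_s) : R[i] :=
  \prod_(a < s) xi R (m a) ^ v 0 a.

Definition entrywise_mul (s : nat) (v w : 'rV[int]_s) : 'rV[int]_s :=
  map2_mx *%R v w.

(* K^v for an integer vector v: since K_a ^ m_a = 1, the exponent v_a is taken *)
(* to be its residue in {0, ..., m_a - 1}.                                     *)
Definition Kpow (A : pzRingType) (s : nat) (m : 'I_s -> nat) (K : 'I_s -> A)
    (v : 'rV[int]_s) : A :=
  \prod_(a < s) K a ^+ absz (modz (v 0 a) (m a)).

Record nenciu_relations (R : realType) (s t : nat) (m : 'I_s -> nat)
    (d u : 'M[int]_(t, s)) (A : algType R[i]) (K : 'I_s -> A) (X : 'I_t -> A) :
    Prop := NenciuRelations {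
  nenciu_K_order : forall a, K a ^+ m a = 1;
  nenciu_KK : forall a b, K a * K b = K b * K a;
  nenciu_KX : forall a k, K a * X k = xi R (m a) ^ d k a *: (X k * K a);
  nenciu_X_nil : forall k, X k ^+ 2 = 0;
  nenciu_XX : forall k l,
    X l * X k = xipow R m (entrywise_mul (row k d) (row l u)) *: (X k * X l)
}.

(* H, with generators K and X, is the Hopf algebra H(m, t, d, u): its          *)
(* underlying algebra is the one presented by these generators and relations.  *)
(* The values antipode (K a) = (K a)^-1 are forced by K a being grouplike.     *)
Record is_nenciu (R : realType) (s t : nat) (m : 'I_s -> nat)
    (d u : 'M[int]_(t, s)) (H : hopfAlgType R[i]) (K : 'I_s -> H) (X : 'I_t -> H) :
    Prop := IsNenciu {
  nenciu_rel : nenciu_relations m d u K X;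
  nenciu_universal : forall (A : algType R[i]) (K' : 'I_s -> A) (X' : 'I_t -> A),
    nenciu_relations m d u K' X' ->
    exists f : {lrmorphism H -> A},
      [/\ forall a, f (K a) = K' a, forall k, f (X k) = X' k
        & forall g : {lrmorphism H -> A},
            (forall a, g (K a) = K' a) -> (forall k, g (X k) = X' k) -> g =1 f];
  nenciu_comulK : forall a, tensor_eq (comul (K a)) [:: (K a, K a)];
  nenciu_counitK : forall a, counit (K a) = 1;
  nenciu_comulX : forall k,
    tensor_eq (comul (X k)) [:: (1, X k); (X k, Kpow m K (row k u))];
  nenciu_counitX : forall k, counit (X k) = 0;
  nenciu_antipodeX : forall k, antipode (X k) = - (X k * Kpow m K (- row k u))
}.

Definition phi (R : realType) (s : nat) (m : 'I_s -> nat) (A : algType R[i])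
    (K : 'I_s -> A) (a : 'I_s) (p : 'I_(m a)) : A :=
  (m a)%:R^-1 *: \sum_(j < m a) xi R (m a) ^- (j * p)%N *: K a ^+ j.

(* The index set Z_m is {dffun forall a, 'I_(m a)}: only residues matter. *)
Definition omega (R : realType) (s : nat) (m : 'I_s -> nat) (A : algType R[i])
    (K : 'I_s -> A) (p : {dffun forall a : 'I_s, 'I_(m a)}) : A :=
  \prod_(a < s) phi K (p a).

(* The left ideal A w, as a submodule of the left regular module A^o. *)
Definition lprincipal (A : nzRingType) (w : A) : pred A^o :=
  fun x => `[< exists h : A, x = h * w >].

Lemma lprincipal_submod (A : nzRingType) (w : A) : submod_closed (lprincipal w).
Proof.
split=> [|c x y /asboolP[h ->] /asboolP[k ->]]; apply/asboolP.
  by exists 0; rewrite mul0r.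
by exists (c * h + k); rewrite mulrDl -mulrA.
Qed.

HB.instance Definition _ (A : nzRingType) (w : A) :=
  GRing.isSubmodClosed.Build A A^o (lprincipal w) (lprincipal_submod w).

Record lideal (A : nzRingType) (w : A) := LIdeal {
  lideal_val :> A^o;
  lideal_valP : lideal_val \in lprincipal w
}.

HB.instance Definition _ (A : nzRingType) (w : A) :=
  [isSub for @lideal_val A w].
HB.instance Definition _ (A : nzRingType) (w : A) := [Choice of lideal w by <:].
HB.instance Definition _ (A : nzRingType) (w : A) :=
  [SubChoice_isSubLmodule of lideal w by <:].

(* The external direct sum of a finite family of left modules. *)
Definition dsum (A : nzRingType) (I : finType) (M : I -> lmodType A) : Type :=
  {dffun forall i : I, M i}.

HB.instance Definition _ (A : nzRingType) (I : finType) (M : I -> lmodType A) :=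
  Choice.on (dsum M).

Definition dsum_zero (A : nzRingType) (I : finType) (M : I -> lmodType A) :
  dsum M := finfun (fun i => 0 : M i).
Definition dsum_opp (A : nzRingType) (I : finType) (M : I -> lmodType A)
  (x : dsum M) : dsum M := finfun (fun i => - x i).
Definition dsum_add (A : nzRingType) (I : finType) (M : I -> lmodType A)
  (x y : dsum M) : dsum M := finfun (fun i => x i + y i).
Definition dsum_scale (A : nzRingType) (I : finType) (M : I -> lmodType A)
  (c : A) (x : dsum M) : dsum M := finfun (fun i => c *: x i).

Fact dsum_addA (A : nzRingType) (I : finType) (M : I -> lmodType A) :
  associative (@dsum_add A I M).
Proof. by move=> x y z; apply/ffunP=> i; rewrite !ffunE addrA. Qed.
Fact dsum_addC (A : nzRingType) (I : finType) (M : I -> lmodType A) :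
  commutative (@dsum_add A I M).
Proof. by move=> x y; apply/ffunP=> i; rewrite !ffunE addrC. Qed.
Fact dsum_add0 (A : nzRingType) (I : finType) (M : I -> lmodType A) :
  left_id (dsum_zero M) (@dsum_add A I M).
Proof. by move=> x; apply/ffunP=> i; rewrite !ffunE add0r. Qed.
Fact dsum_addN (A : nzRingType) (I : finType) (M : I -> lmodType A) :
  left_inverse (dsum_zero M) (@dsum_opp A I M) (@dsum_add A I M).
Proof. by move=> x; apply/ffunP=> i; rewrite !ffunE addNr. Qed.

HB.instance Definition _ (A : nzRingType) (I : finType) (M : I -> lmodType A) :=
  GRing.isZmodule.Build (dsum M) (@dsum_addA A I M) (@dsum_addC A I M)
    (@dsum_add0 A I M) (@dsum_addN A I M).

Fact dsum_scaleA (A : nzRingType) (I : finType) (M : I -> lmodType A)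
    (a b : A) (x : dsum M) : dsum_scale a (dsum_scale b x) = dsum_scale (a * b) x.
Proof. by apply/ffunP=> i; rewrite !ffunE scalerA. Qed.
Fact dsum_scale1 (A : nzRingType) (I : finType) (M : I -> lmodType A) :
  left_id 1 (@dsum_scale A I M).
Proof. by move=> x; apply/ffunP=> i; rewrite !ffunE scale1r. Qed.
Fact dsum_scaleDr (A : nzRingType) (I : finType) (M : I -> lmodType A) :
  right_distributive (@dsum_scale A I M) +%R.
Proof. by move=> a x y; apply/ffunP=> i; rewrite !ffunE scalerDr. Qed.
Fact dsum_scaleDl (A : nzRingType) (I : finType) (M : I -> lmodType A)
    (x : dsum M) : {morph @dsum_scale A I M ^~ x : a b / a + b}.
Proof. by move=> a b; apply/ffunP=> i; rewrite !ffunE scalerDl. Qed.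

HB.instance Definition _ (A : nzRingType) (I : finType) (M : I -> lmodType A) :=
  GRing.Zmodule_isLmodule.Build A (dsum M) (@dsum_scaleA A I M)
    (@dsum_scale1 A I M) (@dsum_scaleDr A I M) (@dsum_scaleDl A I M).

Definition projective (A : nzRingType) (P : lmodType A) : Prop :=
  forall (M N : lmodType A) (g : {linear M -> N}) (f : {linear P -> N}),
    (forall y, exists x, g x = y) ->
    exists h : {linear P -> M}, forall x, g (h x) = f x.

(* The subset S of V is an n-dimensional linear subspace. *)
Definition has_dim (F : fieldType) (V : lmodType F) (S : V -> Prop) (n : nat) :=
  exists e : 'I_n -> V,
    (forall c : 'I_n -> F, \sum_i c i *: e i = 0 -> forall i, c i = 0) /\
    (forall x, S x <-> exists c : 'I_n -> F, x = \sum_i c i *: e i).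

(* The smallest linear subspace containing w and stable under the action of   *)
(* all the x k by left multiplication.                                         *)
Definition gen_by_action (F : fieldType) (A : algType F) (I : Type) (x : I -> A)
    (w : A) : A -> Prop :=
  fun y => forall V : pred A, submod_closed V -> w \in V ->
    (forall k v, v \in V -> x k * v \in V) -> y \in V.

(* Main.v *)
(* Each omega_p is a common eigenvector of the K_a for left multiplication, and *)
(* the omega_p are orthogonal idempotents with sum 1 by orthogonality of roots   *)
(* of unity; this splits the regular module and makes each H omega_p projective. *)
(* Since X_k X^r is a multiple of X^(r + e_k) (or zero), the span of the X^r      *)
(* omega_p is stable under all generators, hence equals H omega_p.  These 2^t     *)
(* vectors are independent because the presentation of H lets it act by monomial *)
(* matrices on a space with basis (e_r), where omega_p fixes e_0 and X^r sends   *)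
(* e_0 to a nonzero multiple of e_r.                                             *)

Require Import Defs.
From HB Require Import structures.
From mathcomp Require Import all_boot all_order all_algebra.
From mathcomp Require Import sesquilinear complex.
From mathcomp Require Import boolp reals trigo.
From mathcomp Require Import ring.

Set Implicit Arguments.
Unset Strict Implicit.
Unset Printing Implicit Defensive.

Import Order.TTheory GRing.Theory Num.Theory.
Local Open Scope ring_scope.

(** The average [phi K p] projects onto the eigenvectors of [K a] with eigenvalue [xi R (m a) ^+ p],
    so the [omega K p] project onto the joint weights of the commuting [K a]. They are orthogonal
    idempotents with sum 1 ([omegaM], [sum_omega]), and over any ring such a family splits the
    regular module into projective left ideals ([lideal_decomposition], [lideal_projective]).

    The dimension of each ideal comes from two uses of the universal property of [H]. Mapping [H] to
    the algebra of elements that preserve a subspace shows that a subspace stable under the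
    generators is stable under [H] ([nenciu_stable]); hence the span of the [Xmon X r * omega K p]
    is the whole ideal ([lprincipal_Xspan]). Mapping [H] to explicit monomial matrices shows that
    these vectors are independent ([Xmon_omega_free]); no basis of [H] is presupposed. *)

(** * Orthogonality of roots of unity *)

Lemma expr_cis (R : realType) (x : R) (k : nat) :
  ((cos x +i* sin x)%C : R[i]) ^+ k = (cos (x *+ k) +i* sin (x *+ k))%C.
Proof.
elim: k => [|k IHk]; first by rewrite expr0 mulr0n cos0 sin0.
rewrite exprSr IHk mulrSr cosD sinD; apply/eqP.
by rewrite eq_complex /=; apply/andP; split; apply/eqP; ring.
Qed.

Lemma xi_expn (R : realType) (n : nat) : (0 < n)%N -> xi R n ^+ n = 1.
Proof.
move=> n0; rewrite /xi expr_cis; have n1 : n%:R != 0 :> R by rewrite pnatr_eq0 -lt0n.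
have -> : (2 * pi / n%:R) *+ n = pi *+ 2 :> R by rewrite -[LHS]mulr_natr; field.
by rewrite cos2pi sin2pi.
Qed.

(** With the half angle [y = pi * (k / n)] strictly between 0 and [pi], the real part is
    [1 - 2 sin(y)^2], which is not 1 since [sin y > 0]. *)
Lemma xi_exp_neq1 (R : realType) (n k : nat) :
  (0 < k < n)%N -> xi R n ^+ k != 1.
Proof.
move=> /andP[k0 kn]; rewrite /xi expr_cis eq_complex /= negb_and.
have n0 : (0 : R) < n%:R by rewrite ltr0n (ltn_trans k0).
have -> : (2 * pi / n%:R) *+ k = (pi * (k%:R / n%:R)) *+ 2 :> R.
  by rewrite -[LHS]mulr_natr; field; rewrite gt_eqF.
set y := pi * _.
have y0 : 0 < sin y.
  apply: sin_gt0_pi; rewrite /y mulr_gt0 ?pi_gt0 ?divr_gt0 ?ltr0n //=; last exact: ltn_trans kn.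
  by rewrite gtr_pMr ?pi_gt0 // ltr_pdivrMr // mul1r ltr_nat.
apply/orP; left; rewrite cos_mulr2n cos2sin2; apply/eqP => h.
have /eqP : sin y ^+ 2 *+ 2 = 0.
  by transitivity (1 - ((1 - sin y ^+ 2) *+ 2 - 1)); [ring | rewrite h subrr].
by rewrite mulrn_eq0 /= sqrf_eq0 (gt_eqF y0).
Qed.

Lemma xi_neq0 (R : realType) (n : nat) : (0 < n)%N -> xi R n != 0.
Proof.
move=> n0; apply: contraTneq (oner_neq0 (R[i])) => xi0.
by rewrite -(xi_expn R n0) xi0 expr0n -[n == _]negbK -lt0n n0 eqxx.
Qed.

Lemma sum_root_powers (F : fieldType) (z : F) (n : nat) :
  z ^+ n = 1 -> z != 1 -> \sum_(j < n) z ^+ j = 0.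
Proof.
move=> zn z1; have /eqP := subrX1 z n; rewrite zn subrr eq_sym mulf_eq0.
by rewrite subr_eq0 (negPf z1) => /eqP.
Qed.

Lemma xi_orthogonality (R : realType) (n : nat) (p q : 'I_n) :
  \sum_(j < n) xi R n ^- (j * p)%N * xi R n ^+ (j * q)%N = (n * (p == q))%:R.
Proof.
have n0 : (0 < n)%N by apply: leq_ltn_trans (ltn_ord p).
have x0 := xi_neq0 R n0.
pose z := xi R n ^- p * xi R n ^+ q.
transitivity (\sum_(j < n) z ^+ j).
  by apply: eq_bigr => j _; rewrite exprMn exprVn -!exprM !(mulnC j).
rewrite {}/z; have [->|pq] := eqVneq p q.
  rewrite muln1 mulVf ?expf_neq0 //.
  by under eq_bigr do rewrite expr1n; rewrite sumr_const card_ord.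
rewrite muln0; apply: sum_root_powers.
  by rewrite exprMn exprVn -!exprM !(mulnC _ n) !exprM xi_expn // !expr1n invr1 mul1r.
apply/eqP => /(congr1 ( *%R (xi R n ^+ p))).
rewrite mulrA mulfV ?expf_neq0 // mul1r mulr1 => /eqP.
(* The claim is symmetric; for [p < q], cancelling [xi R n ^+ p] leaves the exponent [q - p], which
   lies strictly between 0 and [n]. *)
wlog lt_pq : p q pq / (p < q)%N.
  move=> W; case: (ltngtP p q) => [| |/val_inj /eqP]; last by rewrite (negPf pq).
    exact: W.
  by move=> lt_qp; rewrite eq_sym; apply: W; rewrite // eq_sym.
rewrite -{1}(subnK (ltnW lt_pq)) exprD -{2}[xi R n ^+ p]mul1r.
rewrite (inj_eq (mulIf (expf_neq0 _ x0))); apply/negP/xi_exp_neq1.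
by rewrite subn_gt0 lt_pq (leq_ltn_trans (leq_subr _ _)).
Qed.

(** * The idempotents attached to the weights *)

Section Idempotents.
Variables (R : realType) (s : nat) (m : 'I_s -> nat) (A : algType R[i]).
Hypothesis m_gt0 : forall a, (0 < m a)%N.
Variable K : 'I_s -> A.
Local Notation Zm := {dffun forall a : 'I_s, 'I_(m a)}.

(** On an eigenvector the average becomes a sum of scalars, evaluated by orthogonality. Keeping [v]
    arbitrary allows a later use on column vectors of a matrix algebra. *)
Lemma phi_eigen (a : 'I_s) (p q : 'I_(m a)) (v : A) :
  K a * v = xi R (m a) ^+ q *: v -> phi K p * v = (p == q)%:R *: v.
Proof.
move=> Kv; have KXv j : K a ^+ j * v = xi R (m a) ^+ (j * q)%N *: v.
  elim: j => [|j IHj]; first by rewrite mul0n !expr0 mul1r scale1r.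
  by rewrite exprSr -mulrA Kv -scalerAr IHj scalerA mulSn exprD.
rewrite /phi -scalerAl mulr_suml.
under eq_bigr do rewrite -scalerAl KXv scalerA.
rewrite -scaler_suml xi_orthogonality scalerA natrM mulrA mulVf ?mul1r //.
by rewrite pnatr_eq0 -lt0n.
Qed.

Lemma omega_eigen (p q : Zm) (v : A) :
  (forall a, K a * v = xi R (m a) ^+ q a *: v) ->
  omega K p * v = (p == q)%:R *: v.
Proof.
move=> Kv; have -> : (p == q) = all (fun a => p a == q a) (index_enum 'I_s).
  apply/eqP/allP => [-> //|pq]; apply/ffunP=> a; apply/eqP/pq.
  exact: mem_index_enum.
rewrite /omega; elim: (index_enum _) => [|a r IHr] /=.
  by rewrite big_nil mul1r scale1r.
rewrite big_cons -mulrA IHr -scalerAr (phi_eigen _ (Kv a)) scalerA mulrC.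
by rewrite -natrM mulnb.
Qed.

Lemma sum_phi (a : 'I_s) : \sum_(p < m a) phi K p = 1.
Proof.
rewrite /phi -scaler_sumr exchange_big /=.
pose i0 := Ordinal (m_gt0 a).
rewrite (bigD1 i0) //= [X in _ + X]big1 ?addr0 => [|j j0].
  under eq_bigr do rewrite mul0n expr0 invr1 scale1r.
  by rewrite sumr_const card_ord -[K a ^+ 0 *+ _]scaler_nat scalerA mulVf ?scale1r // pnatr_eq0 -lt0n.
rewrite -scaler_suml [X in X *: _](_ : _ = 0) ?scale0r //.
(* Orthogonality with the roles exchanged: the sum runs over [p], and [j] is compared with 0. *)
have := xi_orthogonality R j i0; rewrite (negPf j0) muln0 mulr0n => h; apply: etrans h.
by apply: eq_bigr => p _; rewrite muln0 mulr1 mulnC.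
Qed.

(** Expanding the product over [a] of the sums in [sum_phi] yields this sum. As the range of [p a]
    depends on [a], the expansion passes through functions into the tagged union of the ranges. *)
Lemma sum_omega : \sum_(p : Zm) omega K p = 1.
Proof.
pose T a : finType := 'I_(m a).
pose P a : {ffun T a -> A} := [ffun p => phi K p].
rewrite (reindex (@dffun_of_fprod _ T)) /=; last first.
  exact/onW_bij/dffun_of_fprod_bij.
transitivity (\sum_(x : fprod T) \prod_(a < s) P a (x a)).
  by apply: eq_bigr => x _; apply: eq_bigr => a _; rewrite !ffunE.
(* The default 0 is the value of [untag] at elements whose tag is not [a]; the sums skip them. *)
rewrite big_fprod -(bigA_distr_big_dep (tagged_with T)
  (fun a => untag 0 (P a))) /=.
apply: big1 => a _; rewrite -(sum_phi a).
transitivity (\sum_(j : T a) P a j); last by apply: eq_bigr => p _; rewrite ffunE.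
by rewrite [RHS](big_tag (fun b => fun_of_fin (P b))).
Qed.

Hypothesis K_order : forall a, K a ^+ m a = 1.

Lemma K_phi (a : 'I_s) (p : 'I_(m a)) :
  K a * phi K p = xi R (m a) ^+ p *: phi K p.
Proof.
rewrite /phi -scalerAr scalerA mulrC -scalerA; congr (_ *: _).
pose g j := xi R (m a) ^- (j * p)%N *: K a ^+ j.
rewrite mulr_sumr scaler_sumr.
transitivity (\sum_(j < m a) xi R (m a) ^+ p *: g j.+1).
  apply: eq_bigr => j _; rewrite /g scalerA mulSn exprD invfM mulrA mulfV.
    by rewrite mul1r -scalerAr exprS.
  by rewrite expf_neq0 ?xi_neq0.
rewrite -!scaler_sumr; congr (_ *: _).
have -> : \sum_(j < m a) xi R (m a) ^- (j * p)%N *: K a ^+ j = \sum_(j < m a) g j by [].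
(* Multiplication by [K a] shifts the summation index; this periodicity closes the cycle. *)
have gm : g (m a) = g 0.
  by rewrite /g K_order mul0n exprM xi_expn // expr1n.
case: (m a) gm => [|n gn]; first by rewrite !big_ord0.
by rewrite big_ord_recr [RHS]big_ord_recl /= gn addrC.
Qed.

Hypothesis KK : forall a b, K a * K b = K b * K a.

(** [K a] commutes with the factors of the other indices until it meets its own factor, where
    [K_phi] yields the scalar. *)
Lemma K_omega (p : Zm) (a : 'I_s) :
  K a * omega K p = xi R (m a) ^+ p a *: omega K p.
Proof.
rewrite /omega; have := mem_index_enum a.
elim: (index_enum _) => // b r IHr; rewrite inE big_cons.
have [<- _|ab /IHr {}IHr] := eqVneq a b; first by rewrite mulrA K_phi scalerAl.
suff Kphi : GRing.comm (K a) (phi K (p b)).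
  by rewrite mulrA Kphi -mulrA IHr scalerAr.
rewrite /phi /GRing.comm -scalerAr -scalerAl; congr (_ *: _).
apply: commr_sum => j _; rewrite /GRing.comm -scalerAr -scalerAl.
by congr (_ *: _); apply: commrX; apply: KK.
Qed.

Lemma omegaM (p q : Zm) : omega K p * omega K q = (p == q)%:R *: omega K q.
Proof. by apply: omega_eigen => a; apply: K_omega. Qed.

Lemma omega_idem (p : Zm) : omega K p * omega K p = omega K p.
Proof. by rewrite omegaM eqxx scale1r. Qed.

End Idempotents.

(** * Subspaces stable under the generators *)

(** This subalgebra is made an algebra type of its own so that it can be a target of the universal
    property. *)
Definition stabilizer (F : fieldType) (A : algType F) (V : submodClosed A) : pred A :=
  fun h => `[< forall v, v \in V -> h * v \in V >].

Lemma stabilizer_subalg (F : fieldType) (A : algType F) (V : submodClosed A) :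
  GRing.subsemialg_closed (stabilizer V).
Proof.
split; first by apply/asboolP=> v Vv; rewrite mul1r.
- split=> [|x y /asboolP Vx /asboolP Vy]; apply/asboolP=> v Vv.
    by rewrite mul0r rpred0.
  by rewrite mulrDl rpredD ?Vx ?Vy.
- move=> c x /asboolP Vx; apply/asboolP=> v Vv.
  by rewrite -scalerAl rpredZ ?Vx.
by move=> x y /asboolP Vx /asboolP Vy; apply/asboolP=> v Vv; rewrite -mulrA Vx ?Vy.
Qed.

HB.instance Definition _ (F : fieldType) (A : algType F) (V : submodClosed A) :=
  GRing.isSubalgClosed.Build F A (stabilizer V) (stabilizer_subalg V).

Record stab_alg (F : fieldType) (A : algType F) (V : submodClosed A) := StabAlg {
  stab_val :> A;
  stab_valP : stab_val \in stabilizer V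
}.

HB.instance Definition _ (F : fieldType) (A : algType F) (V : submodClosed A) :=
  [isSub for @stab_val F A V].
HB.instance Definition _ (F : fieldType) (A : algType F) (V : submodClosed A) :=
  [Choice of stab_alg V by <:].
HB.instance Definition _ (F : fieldType) (A : algType F) (V : submodClosed A) :=
  [SubChoice_isSubAlgebra of stab_alg V by <:].

Definition stab_incl (F : fieldType) (A : algType F) (V : submodClosed A) :
  stab_alg V -> A := \val.
HB.instance Definition _ (F : fieldType) (A : algType F) (V : submodClosed A) :=
  GRing.Linear.copy (@stab_incl F A V) \val.
HB.instance Definition _ (F : fieldType) (A : algType F) (V : submodClosed A) :=
  GRing.RMorphism.copy (@stab_incl F A V) \val.

(* The stabilizer of V contains the generators, so the presentation maps H to  *)
(* it; followed by the inclusion this is the identity, by uniqueness.          *)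
Lemma nenciu_stable (R : realType) (s t : nat) (m : 'I_s -> nat)
    (d u : 'M[int]_(t, s)) (H : hopfAlgType R[i]) (K : 'I_s -> H) (X : 'I_t -> H)
    (V : submodClosed H) :
  is_nenciu m d u K X ->
  (forall a v, v \in V -> K a * v \in V) ->
  (forall k v, v \in V -> X k * v \in V) ->
  forall h v, v \in V -> h * v \in V.
Proof.
move=> hH VK VX.
have SK a : K a \in stabilizer V by apply/asboolP; apply: VK.
have SX k : X k \in stabilizer V by apply/asboolP; apply: VX.
pose K' a : stab_alg V := StabAlg (SK a).
pose X' k : stab_alg V := StabAlg (SX k).
have [hord hKK hKX hnil hXX] := nenciu_rel hH.
have rel' : nenciu_relations m d u K' X'.
  split=> [a|a b|a k|k|k l]; apply: val_inj.
  - by rewrite rmorphXn rmorph1 /= hord.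
  - by rewrite !rmorphM /= hKK.
  - by rewrite linearZ !rmorphM /= hKX.
  - by rewrite rmorphXn rmorph0 /= hnil.
  - by rewrite linearZ !rmorphM /= hXX.
have [f [fK fX _]] := nenciu_universal hH rel'.
have [g [gK gX g_uniq]] := nenciu_universal hH (nenciu_rel hH).
pose i : {lrmorphism H -> H} :=
  @stab_incl _ _ V \o f.
move=> h; have <- : i h = h.
  rewrite (g_uniq i) => [|a|k]; first by rewrite -(g_uniq idfun).
    by rewrite /= fK.
  by rewrite /= fX.
exact/asboolP/(stab_valP (f h)).
Qed.

(** * The span of the monomials applied to a vector *)

(** An exponent vector in {0,1}^t is encoded by its support; the factors appear in increasing order
    of index. *)
Definition Xmon (A : pzRingType) (t : nat) (X : 'I_t -> A) (r : {set 'I_t}) : A :=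
  \prod_(k < t | k \in r) X k.

Definition Xspan (F : fieldType) (A : algType F) (t : nat) (X : 'I_t -> A) (w : A) :
  pred A := fun x => `[< exists c : {set 'I_t} -> F, x = \sum_r c r *: (Xmon X r * w) >].

Lemma Xspan_submod (F : fieldType) (A : algType F) (t : nat) (X : 'I_t -> A) (w : A) :
  submod_closed (Xspan X w).
Proof.
split=> [|c x y /asboolP[b ->] /asboolP[b' ->]]; apply/asboolP.
  by exists (fun _ => 0); rewrite big1 // => r _; rewrite scale0r.
exists (fun r => c * b r + b' r); rewrite scaler_sumr -big_split /=.
by apply: eq_bigr => r _; rewrite scalerA scalerDl.
Qed.

HB.instance Definition _ (F : fieldType) (A : algType F) (t : nat) (X : 'I_t -> A)
  (w : A) := GRing.isSubmodClosed.Build F A (Xspan X w) (Xspan_submod X w).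

Lemma Xmon_Xspan (F : fieldType) (A : algType F) (t : nat) (X : 'I_t -> A) (w : A) r :
  Xmon X r * w \in Xspan X w.
Proof.
apply/asboolP; exists (fun r' => (r' == r)%:R); rewrite (bigD1 r) //= eqxx scale1r.
by rewrite big1 ?addr0 // => r' /negPf ->; rewrite scale0r.
Qed.

Lemma Xspan_self (F : fieldType) (A : algType F) (t : nat) (X : 'I_t -> A) (w : A) :
  w \in Xspan X w.
Proof.
have := Xmon_Xspan X w set0.
by rewrite {1}/Xmon big_pred0 ?mul1r // => k; rewrite inE.
Qed.

Lemma Xspan_gen (F : fieldType) (A : algType F) (t : nat) (X : 'I_t -> A) (w x : A) :
  x \in Xspan X w -> gen_by_action X w x.
Proof.
move=> /asboolP[c ->] V Vcl wV VX.
(* Packing the closure proof with [V] makes the [rpred] lemmas applicable. *)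
pose V' : submodClosed A := HB.pack V (GRing.isSubmodClosed.Build F A V Vcl).
suff : \sum_r c r *: (Xmon X r * w) \in V' by [].
apply: rpred_sum => r _; apply: rpredZ; rewrite /Xmon.
elim/big_rec: _ => [|k y _ yV]; first by rewrite mul1r.
by rewrite -mulrA; apply: VX.
Qed.

Section Monomials.
Variables (R : realType) (s t : nat) (m : 'I_s -> nat) (d u : 'M[int]_(t, s)).
Variables (A : algType R[i]) (K : 'I_s -> A) (X : 'I_t -> A).
Hypothesis rel : nenciu_relations m d u K X.

(** [X k] moves right, at the cost of scalars, up to its place in the order; there it is inserted,
    or squares to zero if already present. A general list [e] makes the induction possible. *)
Lemma X_prod (k : 'I_t) (r : {set 'I_t}) (e : seq 'I_t) : uniq e -> k \in e ->
  exists c, X k * \prod_(l <- e | l \in r) X l =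
            c *: \prod_(l <- e | l \in k |: r) X l.
Proof.
elim: e => //= l e IHe /andP[le ue]; rewrite inE !big_cons in_setU1.
have [kl|kl] := eqVneq k l; last first.
  move=> /= /(IHe ue)[c IH].
  case: ifP => _; last by exists c.
  exists (xipow R m (entrywise_mul (row l d) (row k u)) * c).
  rewrite mulrA (nenciu_XX rel) -scalerAl -mulrA IH.
  by rewrite -scalerAr scalerA.
move=> _; rewrite -{}kl /= in le *; case: ifP => kr.
  by exists 0; rewrite mulrA -expr2 (nenciu_X_nil rel) mul0r scale0r.
(* By uniqueness [k] is absent from the tail, where [r] and [k |: r] therefore select the same
   indices. *)
exists 1; rewrite scale1r; congr (_ * _); rewrite big_seq_cond [RHS]big_seq_cond.
apply: eq_bigl => l' /=; have [l'e|//] := boolP (l' \in e).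
by rewrite in_setU1; case: eqVneq => // l'k; rewrite -l'k l'e in le.
Qed.

Lemma X_Xmon (k : 'I_t) (r : {set 'I_t}) :
  exists c, X k * Xmon X r = c *: Xmon X (k |: r).
Proof. by apply: X_prod; rewrite ?index_enum_uniq ?mem_index_enum. Qed.

Lemma K_Xmon (a : 'I_s) (r : {set 'I_t}) :
  exists c, K a * Xmon X r = c *: (Xmon X r * K a).
Proof.
rewrite /Xmon; elim/big_rec: _ => [|k x _ [c IH]].
  by exists 1; rewrite mulr1 mul1r scale1r.
exists (xi R (m a) ^ d k a * c).
by rewrite mulrA (nenciu_KX rel) -scalerAl -(mulrA (X k) (K a)) IH -scalerAr scalerA mulrA.
Qed.

Lemma Xspan_X (w : A) (k : 'I_t) (v : A) :
  v \in Xspan X w -> X k * v \in Xspan X w.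
Proof.
case/asboolP=> b ->; rewrite mulr_sumr; apply: rpred_sum => r _.
rewrite -scalerAr rpredZ // mulrA; have [c ->] := X_Xmon k r.
by rewrite -scalerAl rpredZ ?Xmon_Xspan.
Qed.

Lemma Xspan_K (w : A) (a : 'I_s) (v : A) :
  (exists c, K a * w = c *: w) -> v \in Xspan X w -> K a * v \in Xspan X w.
Proof.
move=> [c' Kw] /asboolP[b ->]; rewrite mulr_sumr; apply: rpred_sum => r _.
rewrite -scalerAr rpredZ // mulrA; have [c ->] := K_Xmon a r.
by rewrite -scalerAl -mulrA Kw -scalerAr !rpredZ ?Xmon_Xspan.
Qed.

End Monomials.

(** * Monomial matrices over a finite index type *)

Section MonomialMatrices.
Variables (F : fieldType) (T : finType).
Hypothesis T_gt0 : (0 < #|T|)%N.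
Local Notation N := (#|T|.-1).

(** The size is written as a successor so that the square matrices form a nonzero ring. *)
Definition mx_index (x : T) : 'I_N.+1 := cast_ord (esym (prednK T_gt0)) (enum_rank x).

Lemma mx_index_bij : bijective mx_index.
Proof.
exists (fun i => enum_val (cast_ord (prednK T_gt0) i)) => x.
  by rewrite /mx_index cast_ordKV enum_rankK.
by rewrite /mx_index enum_valK cast_ordK.
Qed.

(** The operator sending the basis vector e_x to [g x] times e_(f x). *)
Definition monomx (f : T -> T) (g : T -> F) : 'M[F]_N.+1 :=
  \sum_x g x *: delta_mx (mx_index (f x)) (mx_index x).

Lemma monomxM f g f' g' :
  monomx f g * monomx f' g' = monomx (f \o f') (fun x => g (f' x) * g' x).
Proof.
rewrite /monomx mulr_suml; under eq_bigr do rewrite mulr_sumr.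
rewrite exchange_big; apply: eq_bigr => y _ /=.
rewrite (bigD1 (f' y)) //= -scalerAl -scalerAr scalerA.
rewrite /GRing.mul /= mul_delta_mx big1 ?addr0 // => x xy.
rewrite -scalemxAl -scalemxAr mul_delta_mx_0 ?scaler0 //.
by rewrite (inj_eq (bij_inj mx_index_bij)).
Qed.

Lemma monomx1 : monomx id (fun _ => 1) = 1.
Proof.
rewrite -[RHS]/(1%:M) mx1_sum_delta (reindex mx_index) /=; last exact/onW_bij/mx_index_bij.
by apply: eq_bigr => x _; rewrite scale1r.
Qed.

Lemma monomxZ c f g : c *: monomx f g = monomx f (fun x => c * g x).
Proof. by rewrite scaler_sumr; apply: eq_bigr => x _; rewrite scalerA. Qed.

Lemma monomx0 f : monomx f (fun _ => 0) = 0.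
Proof. by rewrite /monomx big1 // => x _; rewrite scale0r. Qed.

Lemma eq_monomx f g f' g' : g =1 g' -> (forall x, g x != 0 -> f x = f' x) ->
  monomx f g = monomx f' g'.
Proof.
move=> gg ff; apply: eq_bigr => x _; rewrite -gg.
by have [->|/ff ->] := eqVneq (g x) 0; rewrite ?scale0r.
Qed.

Lemma monomxX g n : monomx id g ^+ n = monomx id (fun x => g x ^+ n).
Proof.
elim: n => [|n IHn]; first by rewrite expr0 -monomx1.
by rewrite exprS IHn monomxM; apply: eq_monomx => x //; rewrite exprS.
Qed.

(* All columns are e_x, so that operators act by ring multiplication. *)
Definition vecmx (x : T) : 'M[F]_N.+1 := monomx (fun _ => x) (fun _ => 1).

Lemma monomx_vec f g x : monomx f g * vecmx x = g x *: vecmx (f x).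
Proof. by rewrite monomxM monomxZ. Qed.

Lemma vecmx_free (c : T -> F) : \sum_x c x *: vecmx x = 0 -> forall x, c x = 0.
Proof.
move=> c0 x; have /matrixP/(_ (mx_index x) (mx_index x)) := c0.
rewrite mxE summxE => <-; rewrite (bigD1 x) //= mxE [X in _ * X](_ : _ = 1).
  rewrite mulr1 big1 ?addr0 // => y yx.
  rewrite mxE summxE big1 ?mulr0 // => z _.
  by rewrite !mxE (inj_eq (bij_inj mx_index_bij)) eq_sym (negPf yx) mulr0.
rewrite summxE (bigD1 x) //= !mxE !eqxx mulr1 big1 ?addr0 // => y yx.
by rewrite !mxE eqxx (inj_eq (bij_inj mx_index_bij)) eq_sym (negPf yx) mulr0.
Qed.

End MonomialMatrices.

(** * A matrix representation and linear independence *)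

Section Independence.
Variables (R : realType) (s t : nat) (m : 'I_s -> nat).
Hypothesis m_gt0 : forall a, (0 < m a)%N.
Variables (d u : 'M[int]_(t, s)).
Local Notation q k l := (xipow R m (entrywise_mul (row k d) (row l u))).
Hypothesis qq : forall k l : 'I_t, q k l * q l k = 1.
Variable p : {dffun forall a : 'I_s, 'I_(m a)}.

Lemma card_sets_gt0 : (0 < #|{set 'I_t}|)%N.
Proof. by apply/card_gt0P; exists set0. Qed.

Local Notation mono := (monomx (F := R[i]) card_sets_gt0).
Local Notation vec := (vecmx (R[i]) card_sets_gt0).

(* The module with basis X^r w_p, written out: K_a has weight given by p and d, *)
(* and X_k picks up q l k when moved past each X_l with l < k.                  *)
Definition Kcoef (a : 'I_s) (r : {set 'I_t}) : R[i] :=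
  xi R (m a) ^+ p a * \prod_(k in r) xi R (m a) ^ d k a.
Definition Xcoef (k : 'I_t) (r : {set 'I_t}) : R[i] :=
  if k \in r then 0 else \prod_(l in r | (l < k)%N) q l k.
Definition Kmx (a : 'I_s) := mono id (Kcoef a).
Definition Xmx (k : 'I_t) := mono (fun r => k |: r) (Xcoef k).

Lemma Xcoef_neq0 (k : 'I_t) (r : {set 'I_t}) : k \notin r -> Xcoef k r != 0.
Proof.
rewrite /Xcoef => /negPf ->; apply/prodf_neq0 => l _.
by apply: contra_eq_neq (qq l k) => ->; rewrite mul0r eq_sym oner_eq0.
Qed.

(** [X l] has to pass the new factor [X k] exactly when [k < l]. *)
Lemma Xcoef_setU1 (k l : 'I_t) (r : {set 'I_t}) : k != l -> k \notin r ->
  Xcoef l (k |: r) = (if (k < l)%N then q k l else 1) * Xcoef l r.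
Proof.
move=> kl kr; rewrite /Xcoef in_setU1 eq_sym (negPf kl) /=.
case: ifP => lr; first by rewrite mulr0.
have -> b : (if (k < l)%N then q k l else 1) * b =
  (\prod_(j in [set k] | (j < l)%N) q j l) * b.
  by congr (_ * _); rewrite big_mkcondr big_set1.
rewrite !big_mkcondr /= big_setU1 //=; congr (_ * _).
by rewrite big_set1.
Qed.

Lemma Kmx_Xmx_relations : nenciu_relations m d u Kmx Xmx.
Proof.
split=> [a|a b|a k|k|k l].
- rewrite /Kmx monomxX -(monomx1 _ card_sets_gt0); apply: eq_monomx => [r|//].
  rewrite /Kcoef exprMn -exprM mulnC exprM xi_expn // expr1n mul1r -prodrXl.
  by apply: big1 => k _; rewrite exprnP exprzAC -exprnP xi_expn ?exp1rz.
- rewrite [LHS]monomxM [RHS]monomxM.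
  by apply: eq_monomx => [r|//]; exact: mulrC.
- rewrite [Xmx k * Kmx a]monomxM [LHS]monomxM monomxZ.
  apply: eq_monomx => [r /=|//].
  rewrite /Xcoef; case: ifP => [|/negbT kr]; first by rewrite !(mulr0, mul0r).
  by rewrite /Kcoef big_setU1 //=; ring.
- rewrite expr2 [LHS]monomxM -(monomx0 _ card_sets_gt0 (fun r => k |: (k |: r))).
  by apply: eq_monomx => [r|//]; rewrite /Xcoef in_setU1 eqxx mul0r.
rewrite [Xmx k * Xmx l]monomxM [LHS]monomxM monomxZ; apply: eq_monomx => r /=; last by rewrite setUCA.
have [<-|kl] := eqVneq k l.
  by rewrite /Xcoef in_setU1 eqxx !mul0r mulr0.
have [kr|kr] := boolP (k \in r).
  by rewrite /Xcoef !in_setU1 kr !orbT !(mulr0, mul0r).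
have [lr|lr] := boolP (l \in r).
  by rewrite /Xcoef !in_setU1 lr !orbT !(mulr0, mul0r).
rewrite !Xcoef_setU1 //; last by rewrite eq_sym.
(* For [k < l] the left side picks up [q k l]; for [l < k] the right side picks up [q l k], which
   cancels [q k l] by [qq]. *)
case: (ltngtP k l) => [_|_|/val_inj/eqP]; last by rewrite (negPf kl).
  by ring.
by rewrite !mulrA qq; ring.
Qed.

(** Starting from the empty set, each factor adds an index not yet present, so its coefficient is
    nonzero by [Xcoef_neq0]. *)
Lemma Xmon_vec (r : {set 'I_t}) :
  exists2 c, c != 0 & Xmon Xmx r * vec set0 = c *: vec r.
Proof.
have prod_vec (e : seq 'I_t) : uniq e -> exists2 c, c != 0 &
    \prod_(k <- e | k \in r) Xmx k * vec set0 = c *: vec [set k in r | k \in e].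
  elim: e => [_|k e IHe /= /andP[ke /IHe[c c0 IH]]].
    exists 1; rewrite ?oner_neq0 // big_nil mul1r scale1r; congr (vec _).
    by apply/setP=> k; rewrite !inE andbF.
  rewrite big_cons; case: ifP => kr; last first.
    exists c; rewrite // IH; congr (_ *: vec _); apply/setP=> l; rewrite !inE.
    by case: eqVneq => // ->; rewrite kr.
  exists (c * Xcoef k [set l in r | l \in e]).
    by rewrite mulf_neq0 // Xcoef_neq0 // inE (negPf ke) andbF.
  rewrite -mulrA IH -scalerAr monomx_vec scalerA; congr (_ *: vec _).
  by apply/setP=> l; rewrite !inE; case: eqVneq => // ->; rewrite kr.
have [c c0 cE] := prod_vec _ (index_enum_uniq 'I_t); exists c => //.
by rewrite /Xmon cE; congr (_ *: vec _); apply/setP=> k; rewrite !inE mem_index_enum andbT.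
Qed.

Lemma omega_vec : omega Kmx p * vec set0 = vec set0.
Proof.
rewrite (@omega_eigen _ _ _ _ m_gt0 _ p p) ?eqxx ?scale1r // => a.
by rewrite monomx_vec /Kcoef big_set0 mulr1.
Qed.

Lemma rmorph_omega (A B : algType R[i]) (f : {lrmorphism A -> B}) (K : 'I_s -> A)
    (K' : 'I_s -> B) :
  (forall a, f (K a) = K' a) -> f (omega K p) = omega K' p.
Proof.
move=> fK; rewrite /omega rmorph_prod /=; apply: eq_bigr => a _.
rewrite /phi linearZ linear_sum /=; congr (_ *: _); apply: eq_bigr => j _.
by rewrite linearZ /= rmorphXn /= fK.
Qed.

Lemma rmorph_Xmon (A B : algType R[i]) (f : {lrmorphism A -> B}) (X : 'I_t -> A)
    (X' : 'I_t -> B) r :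
  (forall k, f (X k) = X' k) -> f (Xmon X r) = Xmon X' r.
Proof. by move=> fX; rewrite /Xmon rmorph_prod /=; apply: eq_bigr => k _. Qed.

(** The representation, evaluated at the vector of the empty set, turns a relation into one among
    the independent [vec r], with each [c r] multiplied by a nonzero scalar. *)
Lemma Xmon_omega_free (H : hopfAlgType R[i]) (K : 'I_s -> H) (X : 'I_t -> H)
    (c : {set 'I_t} -> R[i]) :
  is_nenciu m d u K X ->
  \sum_r c r *: (Xmon X r * omega K p) = 0 -> forall r, c r = 0.
Proof.
move=> hH c0 r; have [f [fK fX _]] := nenciu_universal hH Kmx_Xmx_relations.
have /choice[b /all_and2[b0 bE]] r' : exists b, b != 0 /\
    Xmon Xmx r' * vec set0 = b *: vec r'.
  by have [b b0 bE] := Xmon_vec r'; exists b.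
have : \sum_r' (c r' * b r') *: vec r' = 0.
  transitivity (f (\sum_r' c r' *: (Xmon X r' * omega K p)) * vec set0).
    rewrite linear_sum mulr_suml; apply: eq_bigr => r' _ /=.
    rewrite linearZ rmorphM /= (rmorph_omega fK) (rmorph_Xmon _ fX) -scalerAl.
    by rewrite -mulrA omega_vec bE scalerA.
  by rewrite c0 linear0 mul0r.
by move=> /vecmx_free/(_ r)/eqP; rewrite mulf_eq0 (negPf (b0 r)) orbF => /eqP.
Qed.

End Independence.

(** * Left ideals generated by idempotents of a ring *)

(** If [y] is a preimage of [f w], the lift is [x] acting on [y]: it maps to the value of [f] at
    [x * w], and [x * w = x] on the ideal. *)
Lemma lideal_projective (A : nzRingType) (w : A) : w * w = w -> projective (lideal w).
Proof.
move=> ww M N g f g_surj.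
have wP : (w : A^o) \in lprincipal w by apply/asboolP; exists 1; rewrite mul1r.
have [y gy] := g_surj (f (LIdeal wP)).
pose h (x : lideal w) : M := (lideal_val x : A) *: y.
have h_lin : linear h by move=> c x z; rewrite /h /= scalerDl scalerA.
pose h' : {linear lideal w -> M} :=
  HB.pack h (GRing.isLinear.Build A (lideal w) M *:%R h h_lin).
exists h' => x /=.
rewrite /h linearZ /= gy -linearZ; congr (f _); apply: val_inj => /=.
have /asboolP[b ->] := lideal_valP x.
by rewrite /GRing.scale /= -mulrA ww.
Qed.

(** The isomorphism sends [x] to the family of the [x * e i]; its inverse adds up the components.
    Idempotency follows by multiplying the sum by [e i]. *)
Lemma lideal_decomposition (A : nzRingType) (I : finType) (e : I -> A) :
  \sum_i e i = 1 -> (forall i j, i != j -> e i * e j = 0) ->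
  exists f : {linear A^o -> dsum (fun i => lideal (e i))}, bijective f.
Proof.
move=> e1 eo.
have ee i : e i * e i = e i.
  rewrite -[RHS]mul1r -e1 mulr_suml (bigD1 i) //= big1 ?addr0 // => j.
  exact: eo.
have eP (x : A) i : (x * e i : A^o) \in lprincipal (e i) by apply/asboolP; exists x.
pose f (x : A^o) : dsum (fun i => lideal (e i)) := [ffun i => LIdeal (eP x i)].
have f_lin : linear f.
  move=> c x y; apply/ffunP=> i; rewrite !ffunE; apply: val_inj => /=.
  by rewrite mulrDl -mulrA.
pose f' : {linear A^o -> dsum (fun i => lideal (e i))} :=
  HB.pack f (GRing.isLinear.Build A A^o _ *:%R f f_lin).
exists f' => /=.
exists (fun y : dsum (fun i => lideal (e i)) => \sum_i lideal_val (y i) : A^o) => [x|y].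
  by under eq_bigr do rewrite ffunE /=; rewrite -mulr_sumr e1 mulr1.
apply/ffunP=> i; rewrite ffunE; apply: val_inj => /=.
rewrite mulr_suml (bigD1 i) //= big1 ?addr0 => [|j ji].
  by have /asboolP[b ->] := lideal_valP (y i); rewrite -mulrA ee.
by have /asboolP[b ->] := lideal_valP (y j); rewrite -mulrA eo ?mulr0.
Qed.

(** * Dimension of the summands and conclusion *)

Lemma has_dim_finType (F : fieldType) (V : lmodType F) (S : V -> Prop) (T : finType)
    (b : T -> V) :
  (forall c : T -> F, \sum_i c i *: b i = 0 -> forall i, c i = 0) ->
  (forall x, S x <-> exists c : T -> F, x = \sum_i c i *: b i) ->
  has_dim S #|T|.
Proof.
move=> b_free b_span; exists (b \o enum_val).
have reix (c : T -> F) :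
    \sum_i c i *: b i = \sum_(i < #|T|) c (enum_val i) *: b (enum_val i).
  by rewrite (reindex (@enum_val T T)) //; apply/onW_bij/enum_val_bij.
split=> [c c0 i|x].
  rewrite -(enum_valK i); apply: (b_free (c \o enum_rank)); rewrite reix -[RHS]c0.
  by apply: eq_bigr => j _ /=; rewrite enum_valK.
rewrite b_span; split=> -[c ->]; first by exists (c \o enum_val); rewrite reix.
exists (c \o enum_rank); rewrite reix.
by apply: eq_bigr => j _ /=; rewrite enum_valK.
Qed.

(** The span contains [w] and is stable under the generators, the [K a] because [w] is a common
    eigenvector; [nenciu_stable] then puts every [h * w] in it. *)
Lemma lprincipal_Xspan (R : realType) (s t : nat) (m : 'I_s -> nat)
    (d u : 'M[int]_(t, s)) (H : hopfAlgType R[i]) (K : 'I_s -> H) (X : 'I_t -> H)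
    (w x : H) :
  is_nenciu m d u K X -> (forall a, exists c, K a * w = c *: w) ->
  x \in lprincipal w <-> x \in Xspan X w.
Proof.
move=> hH Kw; split=> [/asboolP[h ->]|/asboolP[c ->]]; last first.
  apply/asboolP; exists (\sum_r c r *: Xmon X r).
  by rewrite mulr_suml; apply: eq_bigr => r _; rewrite scalerAl.
apply: (nenciu_stable hH) => [a v|k v|].
- exact: (Xspan_K (nenciu_rel hH)).
- exact: (Xspan_X (nenciu_rel hH)).
exact: Xspan_self.
Qed.

Theorem theorem5p7 (R : realType) (s t : nat) (hs : (1 <= s)%N) (ht : (1 <= t)%N)
    (m : 'I_s -> nat) (hm : forall a, (0 < m a)%N) (d u : 'M[int]_(t, s))
    (hdu : forall k l : 'I_t,
       xipow R m (entrywise_mul (row k d) (row l u)) *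
       xipow R m (entrywise_mul (row l d) (row k u)) = 1)
    (hdd : forall k : 'I_t, xipow R m (entrywise_mul (row k d) (row k u)) = -1)
    (H : hopfAlgType R[i]) (K : 'I_s -> H) (X : 'I_t -> H)
    (hH : is_nenciu m d u K X) :
  (exists f : {linear H^o ->
       dsum (fun p : {dffun forall a : 'I_s, 'I_(m a)} => lideal (omega K p))},
     bijective f) /\
  (forall p : {dffun forall a : 'I_s, 'I_(m a)},
     [/\ omega K p * omega K p = omega K p,
         projective (lideal (omega K p)),
         has_dim (fun x : H => x \in lprincipal (omega K p)) (2 ^ t)
       & forall x : H,
           x \in lprincipal (omega K p) <-> gen_by_action X (omega K p) x]).
Proof.
have [K_order KK _ _ _] := nenciu_rel hH.
have eigen (p : {dffun forall a, 'I_(m a)}) a : exists c, K a * omega K p = c *: omega K p.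
  by exists (xi R (m a) ^+ p a); exact: (K_omega hm K_order KK).
split=> [|p].
  apply: lideal_decomposition => [|p q pq]; first exact: (sum_omega hm).
  by rewrite (omegaM hm K_order KK) (negPf pq) scale0r.
have idem : omega K p * omega K p = omega K p by apply: (omega_idem hm K_order KK).
split=> //.
- exact: lideal_projective.
- have -> : (2 ^ t)%N = #|{set 'I_t}|.
    by rewrite -cardsT -powersetT card_powerset cardsT card_ord.
  apply: (has_dim_finType (b := fun r => Xmon X r * omega K p)) => [c|x].
    exact: (Xmon_omega_free hm hdu hH).
  by rewrite (lprincipal_Xspan _ hH) //; split=> [/asboolP|?]; last apply/asboolP.
move=> x; rewrite (lprincipal_Xspan _ hH) //; split=> [|gen_x]; first exact: Xspan_gen.
(* The span is itself one of the stable subspaces over which [gen_by_action] quantifies. *)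
apply: gen_x (Xspan_submod _ _) _ _ => [|k v]; first exact: Xspan_self.
exact: (Xspan_X (nenciu_rel hH)).
Qed.
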